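(* Let $n,d\geq 1$ be integers, let $S=\{1,\ldots,nd+1\}$, and let $L=K_n^d=K(n,S)$ be the Kneser complex. Then $L$ is superstar-transitive.
   Context: The Kneser complex $K(n,S)$ is the simplicial complex whose vertices are all subsets of $S$ of size $n$, and in which a collection of vertices spans a simplex if the corresponding subsets are pairwise disjoint. (For $S=\{1,\ldots,nd+1\}$ it is a $(d-1)$-dimensional flag simplicial complex.) For a simplex $\sigma$ of a simplicial complex $L$, the open star $\mathrm{st}_L(\sigma)$ is the union of all open simplices of $L$ whose closure intersects the closed simplex $\sigma$; an isomorphism between open stars is a bijection between their sets of open simplices preserving dimension and, in both directions, the face relation. $L$ is superstar-transitive if for any two (not necessarily distinct, nonempty) simplices $\sigma,\sigma'$ of $L$ and any isomorphism $\phi:\mathrm{st}_L(\sigma)\to\mathrm{st}_L(\sigma')$ sending $\sigma$ to $\sigma'$, there exists an automorphism $\Phi:L\to L$ with $\Phi|_{\mathrm{st}_L(\sigma)}=\phi$. *)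

(* Defs.v *)
From mathcomp Require Import all_boot all_fingroup.

Set Implicit Arguments.
Unset Strict Implicit.
Unset Printing Implicit Defensive.

(* A finite simplicial complex with vertex set V, each simplex being encoded by
   its nonempty set of vertices. *)
Record complex (V : finType) := Complex {
  simplices :> {set {set V}};
  vertex_simplex : forall v, [set v] \in simplices;
  set0_simplexN : set0 \notin simplices;
  face_simplex : forall s t : {set V},
    s \in simplices -> t \subset s -> t != set0 -> t \in simplices }.

Definition dim (V : finType) (t : {set V}) : nat := #|t|.-1.

(* The realization of L is the disjoint union of its open simplices, so a union
   of open simplices is encoded by the set of simplices involved; the closed
   simplex spanned by s is the union of the open faces of s. *)
Definition closed_simplex (V : finType) (L : complex V) (s : {set V}) :
    {set {set V}} :=
  [set u in L | u \subset s].

Definition open_star (V : finType) (L : complex V) (s : {set V}) :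
    {set {set V}} :=
  [set t in L | closed_simplex L t :&: closed_simplex L s != set0].

(* Only the values of phi on open_star L s matter. *)
Definition open_star_iso (V : finType) (L : complex V) (s s' : {set V})
    (phi : {set V} -> {set V}) : Prop :=
  [/\ {in open_star L s &, injective phi},
      phi @: open_star L s = open_star L s',
      {in open_star L s, forall t : {set V}, dim (phi t) = dim t} &
      {in open_star L s &, forall t u : {set V},
         (phi t \subset phi u) = (t \subset u)}].

Definition automorphism (V : finType) (L : complex V) (Phi : {perm V}) : Prop :=
  forall t : {set V}, (Phi @: t \in L) = (t \in L).

Definition superstar_transitive (V : finType) (L : complex V) : Prop :=
  forall s s' : {set V}, s \in L -> s' \in L ->
  forall phi : {set V} -> {set V},
    open_star_iso L s s' phi -> phi s = s' ->
  exists Phi : {perm V},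
    automorphism L Phi /\
    {in open_star L s, forall t : {set V}, Phi @: t = phi t}.

Section Kneser.

Variables (n : nat) (S : finType).

Definition kneser_vertex : finType := {A : {set S} | #|A| == n}.

Definition kneser_simplices : {set {set kneser_vertex}} :=
  [set s | (s != set0) && trivIset [set val v | v in s]].

Fact kneser_vertex_simplex v : [set v] \in kneser_simplices.
Proof.
rewrite inE -card_gt0 cards1 imset_set1; apply/trivIsetP => A B.
by rewrite !inE => /eqP-> /eqP->; rewrite eqxx.
Qed.

Fact kneser_set0N : set0 \notin kneser_simplices.
Proof. by rewrite inE eqxx. Qed.

Fact kneser_face (s t : {set kneser_vertex}) :
  s \in kneser_simplices -> t \subset s -> t != set0 -> t \in kneser_simplices.
Proof.
rewrite !inE => /andP[_ tri_s] sub_ts ->.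
exact: trivIsetS (imsetS _ sub_ts) tri_s.
Qed.

Definition kneser : complex kneser_vertex :=
  Complex kneser_vertex_simplex kneser_set0N kneser_face.

End Kneser.

(* Main.v *)
Require Import Defs.
From mathcomp Require Import all_boot all_fingroup zify.

Set Implicit Arguments.
Unset Strict Implicit.
Unset Printing Implicit Defensive.

(** A permutation of the ground set S respects disjointness, so it acts on the
    complex; the extension of the given isomorphism phi of open stars is found
    among these automorphisms.

    Fix a vertex v of s.  On the simplices containing v, phi is determined by a
    map f on the vertices at distance at most 1 from v, and f restricts to an
    injection from the n-subsets of the complement of v to the n-subsets of the
    complement of its image v', which preserves disjointness
    ([open_star_iso_local]).  These complements have n(d-1) + 1 points.  Such
    an injection is induced by a bijection of points ([kneser_rigid]): for
    d = 1 there is at most one n-subset, for d = 2 an n-subset is the complement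
    of a point, and for d > 2 the complement has more than 2n points, where the
    Kneser graph is rigid.  The rigidity is proved by recovering the relation
    |A :&: B| >= n-1 from the number of common neighbours of A and B, and then
    by passing from n-subsets to (n-1)-subsets, which are the common
    intersections of the large cliques of that relation ([johnson_rigid]).  The
    resulting bijection of complements extends to a permutation p_v of S
    carrying v to v', and p_v induces phi on all simplices containing v
    ([kneser_star_local]).

    If s has at least two vertices, the permutations p_v have to be glued.  Two
    of them, p_u and p_v, induce the same map on the n-subsets avoiding u and
    v, because phi of a triangle u, v, w is computed by both.  The complement
    of the union of u and v has n(d-2) + 1 points, which is either more than n,
    and then n-subsets separate points, or at most 1; in both cases p_u and p_v
    agree there ([local_perms_agree]).  As the vertices of s are disjoint, every
    point of S is outside of some v in s, and sending x to p_v x for such a v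
    gives one permutation, which induces phi on the whole open star. *)

(** * Permutations and subsets *)

(** The complements of X and of its image have the same size, so they can be
    matched along their enumerations. *)
Lemma perm_extends (T : finType) (X : {set T}) (h : T -> T) :
  {in X &, injective h} -> exists p : {perm T}, {in X, p =1 h}.
Proof.
move=> inj_h; pose E := enum (~: X); pose E' := enum (~: (h @: X)).
have szE : size E = size E'.
  by rewrite -!cardE [LHS]cardsCs [RHS]cardsCs !setCK card_in_imset.
pose g x := if x \in X then h x else nth x E' (index x E).
have gE x : x \notin X -> (g x \notin h @: X) /\ index (g x) E' = index x E.
  move=> xX; have lt_x : index x E < size E'.
    by rewrite -szE index_mem mem_enum inE.
  rewrite /g (negPf xX) index_uniq ?enum_uniq //; split=> //.
  by have := mem_nth x lt_x; rewrite mem_enum inE.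
have inj_g : injective g.
  move=> x y; have [xX|xX] := boolP (x \in X); have [yX|yX] := boolP (y \in X).
  - by rewrite /g xX yX; apply: inj_h.
  - by move=> e; case: (gE y yX); rewrite -e /g xX imset_f.
  - by move=> e; case: (gE x xX); rewrite e /g yX imset_f.
  move=> e; have [_ ix] := gE x xX; have [_ iy] := gE y yX.
  apply: (@index_inj _ x E); rewrite ?mem_enum ?inE //.
  by rewrite -ix e iy.
by exists (perm inj_g) => x xX; rewrite permE /g xX.
Qed.

Lemma perm_extends_onto (T : finType) (X Y : {set T}) (h : T -> T) :
  #|X| = #|Y| -> {in X &, injective h} -> {in X, forall x, h x \in Y} ->
  exists2 p : {perm T}, {in X, p =1 h} & p @: X = Y.
Proof.
move=> eqXY inj_h hY; have [p ph] := perm_extends inj_h.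
exists p => //; apply/eqP; rewrite eqEcard card_imset; last exact: perm_inj.
rewrite eqXY leqnn andbT; apply/subsetP => _ /imsetP[x xX ->].
by rewrite ph // hY.
Qed.

Lemma perm_equicardinal (T : finType) (X Y : {set T}) :
  #|X| = #|Y| -> exists p : {perm T}, p @: X = Y.
Proof.
move=> eXY; pose h x := nth x (enum Y) (index x (enum X)).
have ltE x : x \in X -> index x (enum X) < size (enum Y).
  by move=> xX; rewrite -cardE -eXY cardE index_mem mem_enum.
have [||p _ pX] := perm_extends_onto eXY (h := h); last by exists p.
  move=> x y xX yX; rewrite /h (set_nth_default x) ?ltE //.
  move=> /eqP; rewrite nth_uniq ?enum_uniq ?ltE // => /eqP.
  by apply: (@index_inj _ x); rewrite ?mem_enum.
by move=> x xX; rewrite /h -mem_enum mem_nth ?ltE.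
Qed.

Lemma imset_permC (T : finType) (p : {perm T}) (A : {set T}) :
  p @: (~: A) = ~: (p @: A).
Proof.
apply/setP => x; rewrite -[x](permKV p) inE.
by rewrite !(mem_imset _ _ (@perm_inj _ p)) inE.
Qed.

Lemma sub_extend (T : finType) (B X : {set T}) k :
  B \subset X -> #|B| <= k <= #|X| ->
  exists A : {set T}, [/\ B \subset A, A \subset X & #|A| = k].
Proof.
elim: k => [|k IHk] BX /andP[leBk lekX].
  by exists B; split=> //; move: leBk; rewrite leqn0 => /eqP.
move: leBk; rewrite leq_eqVlt => /predU1P[eB|ltB]; first by exists B; split.
have [A [BA AX cA]] := IHk BX (introT andP (conj ltB (ltnW lekX))).
have /properP[_ [x xX xA]] : A \proper X by rewrite properEcard AX cA.
exists (x |: A); split; last by rewrite cardsU1 xA cA.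
  by rewrite subsetU // BA orbT.
by rewrite subUset sub1set xX.
Qed.

(** If x and y differ, some n-subset of Z contains x but not y; applied to the
    point y that q sends to p x, this forces y = x.  The point y may lie outside
    of Z. *)
Lemma perm_eq_on (T : finType) n (Z : {set T}) (p q : {perm T}) :
  0 < n < #|Z| ->
  (forall A : {set T}, A \subset Z -> #|A| = n -> p @: A = q @: A) ->
  {in Z, p =1 q}.
Proof.
move=> /andP[n0 nZ] epq x xZ; pose y := (q^-1)%g (p x).
have qy : q y = p x by rewrite /y permKV.
have [eyx|nyx] := eqVneq y x; first by rewrite -qy eyx.
have [A [xA AZ cA]] : exists A : {set T},
    [/\ [set x] \subset A, A \subset Z :\ y & #|A| = n].
  apply: sub_extend; first by rewrite sub1set !inE eq_sym nyx xZ.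
  rewrite cards1 n0 /=; have := cardsD1 y Z; lia.
have AZ' : A \subset Z by apply: subset_trans AZ (subD1set _ _).
have : q y \in q @: A by rewrite -epq // qy imset_f // -sub1set.
rewrite mem_imset; last exact: perm_inj.
by move/(subsetP AZ); rewrite !inE eqxx.
Qed.

(** * Cliques of subsets of size k + 1 meeting in k points *)

(** If G is not contained in the union of A and B, it meets this union in at most
    k points, so it meets A, B and their union in the same set. *)
Lemma clique_dichotomy (T : finType) k (A B G : {set T}) :
  #|A :&: B| = k -> #|G| = k.+1 -> k <= #|G :&: A| -> k <= #|G :&: B| ->
  (A :&: B \subset G) || (G \subset A :|: B).
Proof.
move=> cAB cG cGA cGB.
have [sGD|nGD] := boolP (G \subset A :|: B); first by rewrite orbT.
have ltD : #|G :&: (A :|: B)| <= k.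
  rewrite -ltnS -cG; apply: proper_card; rewrite properE subsetIl /=.
  by apply: contra nGD; rewrite subsetI => /andP[].
have eA : G :&: A = G :&: (A :|: B).
  by apply/eqP; rewrite eqEcard setIS ?subsetUl //= (leq_trans ltD).
have eB : G :&: B = G :&: (A :|: B).
  by apply/eqP; rewrite eqEcard setIS ?subsetUr //= (leq_trans ltD).
have sGA : G :&: A \subset A :&: B.
  by rewrite subsetI subsetIr eA -eB subsetIr.
have -> : A :&: B = G :&: A by apply/eqP; rewrite eq_sym eqEcard sGA cAB.
by rewrite subsetIl.
Qed.

(** A clique is either a family of subsets of a (k + 2)-set or a family of sets
    sharing k points; the size excludes the first kind. *)
Lemma large_clique_kernel (T : finType) k (F : {set {set T}}) :
  {in F, forall A : {set T}, #|A| = k.+1} ->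
  {in F &, forall A B : {set T}, k <= #|A :&: B|} ->
  k.+2 < #|F| ->
  #|\bigcap_(A in F) A| = k.
Proof.
move=> cF adjF bigF.
have capE A B : A \in F -> B \in F -> A != B -> #|A :&: B| = k.
  move=> AF BF nAB; apply/eqP; rewrite eqn_leq adjF // andbT -ltnS -(cF A) //.
  apply: proper_card; rewrite properEneq subsetIl andbT.
  apply: contraNneq nAB => /setIidPl sAB.
  by rewrite eqEcard sAB !cF ?leqnn.
have /card_gt1P[A [B [AF BF nAB]]] : 1 < #|F| by lia.
have cC := capE _ _ AF BF nAB; set C := A :&: B in cC.
(* The union of A and B has k + 2 points, hence only k + 2 subsets of size
   k + 1, too few to contain the whole clique. *)
have [E EF nED] : exists2 E, E \in F & ~~ (E \subset A :|: B).
  apply/exists_inP; rewrite -negb_forall_in; apply: contraL bigF.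
  move=> /forall_inP sFD; rewrite -leqNgt.
  have cD : #|A :|: B| = k.+2.
    by have := cardsUI A B; rewrite cC (cF _ AF) (cF _ BF); lia.
  have <- : #|[set X : {set T} | X \subset A :|: B & #|X| == k.+1]| = k.+2.
    by rewrite cards_draws cD binSn.
  by apply/subset_leq_card/subsetP => X XF; rewrite inE sFD //= cF.
have sCE : C \subset E.
  have := @clique_dichotomy _ k A B E cC (cF _ EF).
  by rewrite (negPf nED) orbF; apply; apply: adjF.
have nAE : A != E by apply: contraNneq nED => <-; exact: subsetUl.
have nBE : B != E by apply: contraNneq nED => <-; exact: subsetUr.
have eAE : A :&: E = C.
  by apply/eqP; rewrite eq_sym eqEcard subsetI subsetIl sCE cC capE /= ?leqnn.
have eBE : B :&: E = C.
  by apply/eqP; rewrite eq_sym eqEcard subsetI subsetIr sCE cC capE /= ?leqnn.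
suff sC G : G \in F -> C \subset G.
  rewrite -cC; congr #|pred_of_set _|; apply/eqP; rewrite eqEsubset.
  apply/andP; split; last by apply/bigcapsP.
  by rewrite subsetI !bigcap_inf.
move=> GF; apply: contraT => nCG.
(* A member G without C would lie in A :|: B and in A :|: E, whose intersection
   is A. *)
have sGAB : G \subset A :|: B.
  have := @clique_dichotomy _ k A B G cC (cF _ GF).
  by rewrite (negPf nCG); apply; apply: adjF.
have sGAE : G \subset A :|: E.
  have := @clique_dichotomy _ k A E G; rewrite eAE (negPf nCG).
  by apply; [|apply: cF|apply: adjF|apply: adjF].
have : G \subset A :|: (B :&: E) by rewrite setUIr subsetI sGAB.
rewrite eBE (setUidPl (subsetIl A B)) => sGA.
case/negP: nCG; have /eqP-> : G == A by rewrite eqEcard sGA !cF ?leqnn.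
exact: subsetIl.
Qed.

(** The proof lowers n.  A set C of size n - 1 is encoded by the clique of all
    n-subsets of X containing it.  Cliques of this kind have #|X| - n + 1
    elements, while the cliques of the other kind, inside a set of size n + 1,
    have at most n + 1; as n.*2 < #|X| they cannot be confused.  For n = 1 the
    map is a map of points, whatever the size of X, which is where the descent
    ends. *)
Lemma johnson_rigid (T : finType) n (X Y : {set T}) (f : {set T} -> {set T}) :
  #|X| = #|Y| -> 0 < n -> n.*2 < #|X| \/ n = 1 ->
  (forall A : {set T}, A \subset X -> #|A| = n -> f A \subset Y /\ #|f A| = n) ->
  (forall A B : {set T}, A \subset X -> #|A| = n -> B \subset X -> #|B| = n ->
     f A = f B -> A = B) ->
  (forall A B : {set T}, A \subset X -> #|A| = n -> B \subset X -> #|B| = n ->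
     n.-1 <= #|A :&: B| -> n.-1 <= #|f A :&: f B|) ->
  exists2 p : {perm T}, p @: X = Y &
    forall A : {set T}, A \subset X -> #|A| = n -> f A = p @: A.
Proof.
move=> eXY; case: n => // n _; elim: n f => [|n IHn] f ltX fY inj_f adj_f.
  pose h x := odflt x [pick y in f [set x]].
  have fh x : x \in X -> f [set x] = [set h x].
    move=> xX; have [| |_ /eqP/cards1P[y fy]] := fY [set x].
    - by rewrite sub1set.
    - by rewrite cards1.
    rewrite /h fy; case: pickP => [z|/(_ y)]; last by rewrite !inE eqxx.
    by rewrite inE => /eqP->.
  have [||p ph pX] := perm_extends_onto eXY (h := h).
  - move=> x y xX yX exy; apply: set1_inj; apply: inj_f;
      by rewrite ?cards1 ?sub1set // !fh // exy.
  - move=> x xX; have [||] := fY [set x]; rewrite ?sub1set ?cards1 //.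
    by rewrite fh // sub1set.
  exists p => // A AX /eqP/cards1P[x eA]; rewrite {}eA in AX *.
  by rewrite sub1set in AX; rewrite imset_set1 fh // ph.
case: ltX => // ltX.
(* [star Z C] is the clique of the sets with one more point than C in Z. *)
pose star (Z C : {set T}) := [set x |: C | x in Z :\: C].
have card_star (Z C : {set T}) : C \subset Z -> #|star Z C| = #|Z| - #|C|.
  move=> CZ; rewrite card_in_imset ?cardsD ?(setIidPr CZ) //.
  move=> x y; rewrite !inE => /andP[xC _] /andP[yC _] e.
  have : x \in y |: C by rewrite -e setU11.
  by rewrite !inE (negPf xC) orbF => /eqP.
have starP (Z C A : {set T}) : C \subset Z -> #|C| = n.+1 ->
    reflect [/\ C \subset A, A \subset Z & #|A| = n.+2] (A \in star Z C).
  move=> CZ cC; apply: (iffP imsetP) => [[x]|[CA AZ cA]].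
    rewrite inE => /andP[xC xZ] ->; rewrite subsetUr subUset sub1set xZ CZ.
    by rewrite cardsU1 xC cC.
  have /cards1P[x ex] : #|A :\: C| == 1.
    by rewrite cardsD (setIidPr CA) cA cC; lia.
  have : x \in A :\: C by rewrite ex inE.
  rewrite inE => /andP[xC xA]; exists x; first by rewrite inE xC (subsetP AZ).
  by rewrite -ex setUC setDE setUIr setUCr setIT; apply/esym/setUidPr.
have star_cap (C : {set T}) : C \subset X -> #|C| = n.+1 ->
    \bigcap_(A in star X C) A = C.
  move=> CX cC; have : 1 < #|star X C| by rewrite card_star //; lia.
  case/card_gt1P => A [B [AS BS nAB]]; apply/eqP; rewrite eqEsubset.
  apply/andP; split; last by apply/bigcapsP => G /(starP _ _ _ CX cC)[].
  suff eC : A :&: B = C by rewrite -[in X in _ \subset X]eC subsetI !bigcap_inf.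
  have [CA _ cA] := starP _ _ _ CX cC AS; have [CB _ cB] := starP _ _ _ CX cC BS.
  apply/esym/eqP; rewrite eqEcard subsetI CA CB cC -ltnS -cA; apply: proper_card.
  rewrite properEneq subsetIl andbT; apply: contraNneq nAB => /setIidPl sAB.
  by rewrite eqEcard sAB cA cB leqnn.
(* The image of the clique over C is too large to lie in n + 3 points, so its
   members share n + 1 points: this defines g on the sets C of size n + 1. *)
pose g (C : {set T}) := \bigcap_(A in f @: star X C) A.
have inj_star (C : {set T}) :
    C \subset X -> #|C| = n.+1 -> {in star X C &, injective f}.
  move=> CX cC A B /(starP _ _ _ CX cC)[_ ? ?] /(starP _ _ _ CX cC)[_ ? ?].
  exact: inj_f.
have sgf (C A : {set T}) :
    C \subset A -> A \subset X -> #|C| = n.+1 -> #|A| = n.+2 -> g C \subset f A.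
  move=> CA AX cC cA; apply: bigcap_inf; apply: imset_f.
  by apply/starP => //; apply: subset_trans AX.
have card_g (C : {set T}) : C \subset X -> #|C| = n.+1 -> #|g C| = n.+1.
  move=> CX cC; apply: large_clique_kernel.
  - by move=> _ /imsetP[A /(starP _ _ _ CX cC)[_ ? ?] ->]; case: (fY A).
  - move=> U V /imsetP[A /(starP _ _ _ CX cC)[CA ? ?] ->].
    move=> /imsetP[B /(starP _ _ _ CX cC)[CB ? ?] ->]; apply: adj_f => //=.
    by rewrite -cC subset_leq_card // subsetI CA.
  by rewrite card_in_imset ?card_star //; [lia | exact: inj_star].
have extX (C : {set T}) k : C \subset X -> #|C| <= k <= n.+2 ->
    exists A : {set T}, [/\ C \subset A, A \subset X & #|A| = k].
  by move=> CX ?; apply: sub_extend => //; lia.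
have gY (C : {set T}) : C \subset X -> #|C| = n.+1 -> g C \subset Y.
  move=> CX cC; have [|A [CA AX cA]] := extX C n.+2 CX; first by lia.
  by apply: subset_trans (sgf _ _ CA AX cC cA) _; case: (fY A).
(* Since X and Y have the same size, f carries the clique over C onto the clique
   over g C; this makes g injective. *)
have f_star (C : {set T}) :
    C \subset X -> #|C| = n.+1 -> f @: star X C = star Y (g C).
  move=> CX cC; apply/eqP; rewrite eqEcard; apply/andP; split; last first.
    rewrite card_in_imset; last exact: inj_star.
    by rewrite !card_star ?gY // card_g // cC eXY.
  apply/subsetP => _ /imsetP[A AS ->]; have [CA AX cA] := starP _ _ _ CX cC AS.
  by apply/starP; rewrite ?gY ?card_g // sgf //; case: (fY A).
have [||||p pX pg] := IHn g; rewrite ?gY //.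
- by left; lia.
- by move=> C CX cC; rewrite gY // card_g.
- move=> C D CX cC DX cD eg; rewrite -(star_cap C) // -(star_cap D) //.
  suff -> : star X C = star X D by [].
  have : f @: star X C = f @: star X D by rewrite !f_star // eg.
  have sub (C1 D1 : {set T}) : C1 \subset X -> #|C1| = n.+1 -> D1 \subset X ->
      #|D1| = n.+1 -> f @: star X C1 = f @: star X D1 ->
      star X C1 \subset star X D1.
    move=> CX1 cC1 DX1 cD1 e; apply/subsetP => A AS.
    have : f A \in f @: star X D1 by rewrite -e imset_f.
    case/imsetP => B BS /inj_f ->//.
    + by case/(starP _ _ _ CX1 cC1): AS.
    + by case/(starP _ _ _ CX1 cC1): AS.
    + by case/(starP _ _ _ DX1 cD1): BS.
    + by case/(starP _ _ _ DX1 cD1): BS.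
  by move=> e; apply/eqP; rewrite eqEsubset !sub.
- move=> C D CX cC DX cD /= ltCD; have := cardsUI C D => cU.
  have [||A [CDA AX cA]] := extX (C :|: D) n.+2; rewrite ?subUset ?CX //.
    by lia.
  move: CDA; rewrite subUset => /andP[CA DA].
  have sU : g C :|: g D \subset f A by rewrite subUset !sgf.
  have [_ cfA] := fY A AX cA.
  have := subset_leq_card sU; have := cardsUI (g C) (g D).
  by rewrite !card_g // cfA; lia.
(* A is the union of its subsets C of size n + 1, and p @: C = g C is in f A. *)
exists p => // A AX cA; have [_ cfA] := fY A AX cA.
apply/eqP; rewrite eq_sym eqEcard card_imset; last exact: perm_inj.
rewrite cfA cA leqnn andbT; apply/subsetP => _ /imsetP[x xA ->].
have [C [xC CA cC]] : exists C : {set T},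
    [/\ [set x] \subset C, C \subset A & #|C| = n.+1].
  by apply: sub_extend; rewrite ?sub1set // cards1 cA; lia.
apply: (subsetP (sgf C A CA AX cC cA)).
rewrite pg // ?imset_f // -?sub1set //; exact: subset_trans AX.
Qed.

(** * Injections of n-subsets preserving disjointness *)

Lemma bin_le_cancel n a b : 0 < n <= a -> 'C(a, n) <= 'C(b, n) -> a <= b.
Proof.
case/andP=> n0 na; apply: contraTT; rewrite -!ltnNge => ltba.
apply: leq_ltn_trans (leq_bin2l n (_ : b <= a.-1)) _; first by lia.
case: a n n0 na {ltba} => [|a] [|n] //= _ na.
by rewrite binS -[X in X < _]addn0 ltn_add2l bin_gt0.
Qed.

(** Between n + 2 and 2n points the conclusion may fail: for #|X| = n.*2 every
    n-subset is disjoint from its complement only.  When there are more than 2n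
    points, A and B have binomial (#|X| - #|A :|: B|, n) common neighbours, a
    number which is strictly monotone in #|A :&: B| as long as it is not 0; so
    the pairs with #|A :&: B| >= n - 1 can be recognized, and [johnson_rigid]
    applies. *)
Lemma kneser_rigid (T : finType) n (X Y : {set T}) (f : {set T} -> {set T}) :
  #|X| = #|Y| -> 0 < n -> #|X| <= n.+1 \/ n.*2 < #|X| ->
  (forall A : {set T}, A \subset X -> #|A| = n -> f A \subset Y /\ #|f A| = n) ->
  (forall A B : {set T}, A \subset X -> #|A| = n -> B \subset X -> #|B| = n ->
     f A = f B -> A = B) ->
  (forall A B : {set T}, A \subset X -> #|A| = n -> B \subset X -> #|B| = n ->
     [disjoint A & B] -> [disjoint f A & f B]) ->
  exists2 p : {perm T}, p @: X = Y &
    forall A : {set T}, A \subset X -> #|A| = n -> f A = p @: A.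
Proof.
move=> eXY n0 szX fY inj_f dis_f.
have card_p (p : {perm T}) (A : {set T}) : #|p @: A| = #|A|.
  by apply: card_imset; exact: perm_inj.
have [leXn|ltnX] := leqP #|X| n.
  have [p pX] := perm_equicardinal eXY.
  exists p => // A AX cA; have [fAY cfA] := fY A AX cA.
  have eA : A = X by apply/eqP; rewrite eqEcard AX cA.
  by apply/eqP; rewrite eA pX -eA eqEcard fAY cfA -eXY.
(* With n + 1 points, an n-subset is the complement of a point. *)
have [leXn1|ltn1X] := leqP #|X| n.+1.
  have cX : #|X| = n.+1 by lia.
  pose h x := odflt x [pick y in Y :\: f (X :\ x)].
  have cXx x : x \in X -> #|X :\ x| = n by move=> xX; have := cardsD1 x X; lia.
  have fh x : x \in X -> Y :\: f (X :\ x) = [set h x].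
    move=> xX; have [fXY cfX] := fY _ (subD1set X x) (cXx x xX).
    have /cards1P[y fy] : #|Y :\: f (X :\ x)| == 1.
      by rewrite cardsD (setIidPr fXY) cfX -eXY cX subSnn.
    rewrite /h fy; case: pickP => [z|/(_ y)]; last by rewrite !inE eqxx.
    by rewrite inE => /eqP->.
  have fhX x : x \in X -> f (X :\ x) = Y :\ h x.
    move=> xX; have [fXY _] := fY _ (subD1set X x) (cXx x xX).
    by rewrite -fh // setDDr setDv set0U; apply/esym/setIidPr.
  have [||p ph pX] := perm_extends_onto eXY (h := h).
  - move=> x y xX yX exy; have : X :\ x = X :\ y.
      by apply: inj_f; rewrite ?subD1set ?cXx // !fhX // exy.
    by move/setP/(_ x); rewrite !inE xX eqxx andbT /=; case: eqP.
  - move=> x xX; suff : h x \in Y :\: f (X :\ x) by rewrite inE => /andP[].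
    by rewrite fh ?set11.
  exists p => // A AX cA.
  have /cards1P[x ex] : #|X :\: A| == 1.
    by rewrite cardsD (setIidPr AX) cA cX subSnn.
  have xX : x \in X by have := set11 x; rewrite -ex inE => /andP[].
  have -> : A = X :\ x by rewrite -ex setDDr setDv set0U; apply/esym/setIidPr.
  rewrite fhX //; apply/eqP; rewrite eq_sym eqEcard card_p cXx //.
  rewrite -ph // -pX; apply/andP; split; last first.
    by have := cardsD1 (p x) (p @: X); rewrite imset_f // card_p; lia.
  apply/subsetP => _ /imsetP[y /setD1P[yx yX] ->].
  by rewrite !inE (inj_eq perm_inj) yx imset_f.
apply: johnson_rigid => //; first by lia.
move=> A B AX cA BX cB leAB.
have [fAY cfA] := fY A AX cA; have [fBY cfB] := fY B BX cB.
(* A and B have at least one common neighbour, and f sends common neighbours to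
   common neighbours, so f A :|: f B cannot be larger than A :|: B. *)
pose nbr (Z A B : {set T}) :=
  [set C : {set T} | C \subset Z :\: (A :|: B) & #|C| == n].
have nbrX C : C \in nbr X A B ->
    [/\ C \subset X, #|C| = n, [disjoint C & A] & [disjoint C & B]].
  rewrite inE setDUr subsetI !subsetD.
  by move=> /andP[/andP[/andP[-> ->] /andP[_ ->]] /eqP->].
have : #|nbr X A B| <= #|nbr Y (f A) (f B)|.
  rewrite -(@card_in_imset _ _ f (nbr X A B)); last first.
    by move=> C D /nbrX[? ? _ _] /nbrX[? ? _ _]; apply: inj_f.
  apply/subset_leq_card/subsetP => _ /imsetP[C /nbrX[CX cC CA CB] ->].
  have [fCY cfC] := fY C CX cC.
  by rewrite inE setDUr subsetI !subsetD fCY cfC eqxx !dis_f.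
rewrite !cards_draws => /bin_le_cancel.
have sAB : A :|: B \subset X by rewrite subUset AX.
have sfAB : f A :|: f B \subset Y by rewrite subUset fAY.
rewrite !cardsD (setIidPr sAB) (setIidPr sfAB).
have := cardsUI A B; have := cardsUI (f A) (f B).
have := subset_leq_card sAB; have := subset_leq_card sfAB.
rewrite cA cB cfA cfB eXY => h1 h2 h3 h4 h5.
have {}h5 := h5 ltac:(lia).
lia.
Qed.

(** * Isomorphisms of open stars near a vertex *)

Lemma mem_open_star (V : finType) (L : complex V) (s t : {set V}) v :
  v \in s -> v \in t -> t \in L -> t \in open_star L s.
Proof.
move=> vs vt tL; rewrite inE tL; apply/set0Pn; exists [set v].
by rewrite !inE vertex_simplex !sub1set vt vs.
Qed.

Lemma simplex_neq0 (V : finType) (L : complex V) (t : {set V}) :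
  t \in L -> t != set0.
Proof. by apply: contraTneq => ->; exact: set0_simplexN. Qed.

Lemma edge_simplex (V : finType) (L : complex V) (t : {set V}) v w :
  t \in L -> v \in t -> w \in t -> [set v; w] \in L.
Proof.
move=> tL vt wt; apply: face_simplex tL _ _; first by rewrite subUset !sub1set vt.
by apply/set0Pn; exists v; rewrite set21.
Qed.

Lemma open_star_iso_simplex (V : finType) (L : complex V) (s s' : {set V}) phi t :
  open_star_iso L s s' phi -> t \in open_star L s -> phi t \in L.
Proof.
case=> _ imphi _ _ ts; have : phi t \in open_star L s'.
  by rewrite -imphi imset_f.
by rewrite inE => /andP[].
Qed.

Lemma open_star_iso_card (V : finType) (L : complex V) (s s' : {set V}) phi t :
  open_star_iso L s s' phi -> t \in open_star L s -> #|phi t| = #|t|.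
Proof.
move=> isoP ts; have ptL := open_star_iso_simplex isoP ts.
case: isoP => _ _ dimphi _.
have tL : t \in L by move: ts; rewrite inE => /andP[].
have := dimphi t ts; rewrite /dim.
move: (simplex_neq0 ptL) (simplex_neq0 tL); rewrite -!card_gt0; lia.
Qed.

(** The open star does not contain the vertices outside of s, so phi gives no
    direct map of vertices; but it contains the edges from v, and the image of
    the edge from v to w consists of f v and f w. *)
Lemma open_star_iso_local (V : finType) (L : complex V) (s s' : {set V}) phi v :
  open_star_iso L s s' phi -> v \in s ->
  exists2 f : V -> V, {in [set w | [set v; w] \in L] &, injective f} &
    forall t : {set V}, t \in L -> v \in t -> phi t = f @: t.
Proof.
move=> isoP vs; have [injphi _ _ subphi] := isoP.
have starv (t : {set V}) : t \in L -> v \in t -> t \in open_star L s.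
  by move=> tL vt; exact: mem_open_star vs vt tL.
have vst := starv [set v] (vertex_simplex L v) (set11 v).
have /cards1P[v' phiv] : #|phi [set v]| == 1.
  by rewrite (open_star_iso_card isoP) ?cards1.
pose f w := if w == v then v' else odflt v' [pick x in phi [set v; w] :\ v'].
have fE w : [set v; w] \in L -> phi [set v; w] = [set v'; f w].
  rewrite /f; case: eqP => [->|/eqP nwv] eL; first by rewrite !setUid.
  have est := starv _ eL (set21 v w).
  have v'e : v' \in phi [set v; w].
    by rewrite -sub1set -phiv subphi // sub1set set21.
  have /cards1P[x ex] : #|phi [set v; w] :\ v'| == 1.
    have := cardsD1 v' (phi [set v; w]).
    by rewrite v'e (open_star_iso_card isoP) // cards2 eq_sym nwv add1n => -[<-].
  rewrite ex; case: pickP => [y|/(_ x)]; last by rewrite inE eqxx.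
  by rewrite inE => /eqP-> /=; rewrite -ex setD1K.
have inj_f : {in [set w | [set v; w] \in L] &, injective f}.
  move=> w x; rewrite !inE => wL xL efwx.
  have e : [set v; w] = [set v; x].
    by apply: injphi; rewrite ?starv ?set21 // !fE // efwx.
  have : w \in [set v; x] by rewrite -e set22.
  rewrite !inE => /orP[] /eqP // ewv.
  have : x \in [set v; w] by rewrite e set22.
  by rewrite ewv !inE orbb => /eqP->.
(* The edges from v to the vertices of t already give #|t| vertices of phi t. *)
exists f => // t tL vt; apply/eqP; rewrite eq_sym eqEcard.
have eL w : w \in t -> [set v; w] \in L by apply: edge_simplex.
rewrite card_in_imset; last by move=> w x wt xt; apply: inj_f; rewrite inE eL.
rewrite (open_star_iso_card isoP) ?starv // leqnn andbT.
apply/subsetP => _ /imsetP[w wt ->].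
have : phi [set v; w] \subset phi t.
  by rewrite subphi ?starv ?eL ?set21 // subUset !sub1set vt.
by rewrite fE ?eL // subUset !sub1set => /andP[].
Qed.

(** * The Kneser complex *)

Section KneserComplex.

Variables (n : nat) (S : finType).
Local Notation V := (kneser_vertex n S).
Local Notation L := (kneser n S).

Lemma card_kneser_vertex (v : V) : #|val v| = n.
Proof. exact/eqP/(valP v). Qed.

Lemma kneserP (t : {set V}) :
  reflect (t != set0 /\
           {in t &, forall u v : V, u != v -> [disjoint val u & val v]})
          (t \in L).
Proof.
rewrite inE; apply: (iffP andP) => -[t0 dis_t]; split=> //.
  move=> u v ut vt nuv; apply: (trivIsetP dis_t); rewrite ?imset_f //.
apply/trivIsetP => _ _ /imsetP[u ut ->] /imsetP[v vt ->].
by rewrite (inj_eq val_inj); exact: dis_t.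
Qed.

Definition kneser_act (p : {perm S}) (v : V) : V := insubd v (p @: val v).

Lemma val_kneser_act p v : val (kneser_act p v) = p @: val v.
Proof.
by rewrite val_insubd card_imset ?card_kneser_vertex ?eqxx //; exact: perm_inj.
Qed.

Lemma kneser_act_inj p : injective (kneser_act p).
Proof.
move=> u v /(congr1 val); rewrite !val_kneser_act => e.
by apply: val_inj; apply: imset_inj e; exact: perm_inj.
Qed.

Definition kneser_perm p : {perm V} := perm (@kneser_act_inj p).

Lemma kneser_perm_automorphism p : automorphism L (kneser_perm p).
Proof.
have dis_p (A B : {set S}) : [disjoint p @: A & p @: B] = [disjoint A & B].
  by rewrite -!setI_eq0 -imsetI ?imset_eq0 //; move=> ? ? _ _; exact: perm_inj.
move=> t; apply/kneserP/kneserP => -[]; rewrite imset_eq0 => t0 dis_t; split=> //.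
  move=> u v ut vt nuv.
  rewrite -dis_p -!val_kneser_act.
  apply: dis_t; rewrite ?(inj_eq (@kneser_act_inj p)) //.
    by apply/imsetP; exists u; rewrite ?permE.
  by apply/imsetP; exists v; rewrite ?permE.
move=> _ _ /imsetP[u ut ->] /imsetP[v vt ->].
rewrite (inj_eq perm_inj) !permE !val_kneser_act dis_p; exact: dis_t.
Qed.

End KneserComplex.

Lemma kneser_disjoint_neq n (S : finType) (u v : kneser_vertex n S) :
  0 < n -> [disjoint val u & val v] -> u != v.
Proof.
move=> n0; apply: contraTneq => <-.
by rewrite -setI_eq0 setIid -card_gt0 card_kneser_vertex.
Qed.

Lemma kneser_triangle n (S : finType) (u v w : kneser_vertex n S) :
  (u != v -> [disjoint val u & val v]) ->
  (u != w -> [disjoint val u & val w]) ->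
  (v != w -> [disjoint val v & val w]) ->
  [set u; v; w] \in kneser n S.
Proof.
move=> uv uw vw; apply/kneserP; split.
  by apply/set0Pn; exists u; rewrite !inE eqxx.
move=> a b; rewrite !inE.
case/orP=> [/orP[]|]/eqP-> /orP[/orP[]|]/eqP->.
- by rewrite eqxx.
- exact: uv.
- exact: uw.
- by rewrite eq_sym disjoint_sym; exact: uv.
- by rewrite eqxx.
- exact: vw.
- by rewrite eq_sym disjoint_sym; exact: uw.
- by rewrite eq_sym disjoint_sym; exact: vw.
- by rewrite eqxx.
Qed.

(** The map of [open_star_iso_local] preserves disjointness because two disjoint
    vertices in the link of v span a triangle with v; the permutation given by
    [kneser_rigid] maps the complement of v onto that of f v, hence also v to
    f v. *)
Lemma kneser_star_local n d (S : finType) (s s' : {set kneser_vertex n S}) phi v :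
  0 < n -> 0 < d -> #|S| = n * d + 1 ->
  open_star_iso (kneser n S) s s' phi -> v \in s ->
  exists p : {perm S}, forall t : {set kneser_vertex n S},
    t \in kneser n S -> v \in t -> phi t = kneser_perm n p @: t.
Proof.
move=> n0 d0 cS isoP vs; set L := kneser n S in isoP *.
have [f inj_f phif] := open_star_iso_local isoP vs.
have cv := @card_kneser_vertex n S.
have fL (t : {set kneser_vertex n S}) : t \in L -> v \in t -> f @: t \in L.
  move=> tL vt; rewrite -phif //; apply: (open_star_iso_simplex isoP).
  exact: mem_open_star vs vt tL.
pose V (A : {set S}) : kneser_vertex n S := insubd v A.
have valV (A : {set S}) : #|A| = n -> val (V A) = A.
  by move=> cA; rewrite val_insubd cA eqxx.
have Vval w : V (val w) = w by exact: valKd.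
have triL (w x : kneser_vertex n S) : [disjoint val w & val v] ->
    [disjoint val x & val v] -> w = x \/ [disjoint val w & val x] ->
    [set v; w; x] \in L.
  move=> wv xv wx; apply: kneser_triangle => nwx; rewrite 1?disjoint_sym //.
  by case: wx nwx => [->|]; rewrite ?eqxx 1?disjoint_sym.
have edgeL (w : kneser_vertex n S) : [disjoint val w & val v] -> [set v; w] \in L.
  by move=> wv; have := triL w w wv wv (or_introl erefl); rewrite -setUA setUid.
have fdis (w x : kneser_vertex n S) (t : {set kneser_vertex n S}) :
    t \in L -> v \in t -> w \in t -> x \in t ->
    w != x -> [disjoint val (f w) & val (f x)].
  move=> tL vt wt xt nwx; have /kneserP[_ dis_f] := fL t tL vt.
  apply: dis_f; rewrite ?imset_f //; apply: contraNneq nwx => /inj_f -> //.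
    by rewrite inE; apply: edge_simplex tL vt wt.
  by rewrite inE; apply: edge_simplex tL vt xt.
pose F (A : {set S}) := val (f (V A)).
have subvC (A : {set S}) :
    A \subset ~: val v -> #|A| = n -> [disjoint val (V A) & val v].
  by move=> AX cA; rewrite valV // disjoints_subset.
have cX (w : kneser_vertex n S) : #|~: val w| = n * d + 1 - n.
  by rewrite cardsCs setCK cS cv.
have [||||||p pX pF] := @kneser_rigid _ n (~: val v) (~: val (f v)) F.
- by rewrite !cX.
- by [].
(* n(d-1) + 1 is at most n + 1 for d <= 2 and more than 2n for d > 2. *)
- rewrite cX; case: d d0 {cS cX} => [|[|[|d]]] // _.
  + by left; lia.
  + by left; lia.
  + by right; nia.
- move=> A AX cA; rewrite /F cv; split=> //.
  rewrite -disjoints_subset; apply: (fdis _ _ [set v; V A]);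
    rewrite ?set21 ?set22 ?edgeL ?subvC //.
  by apply: kneser_disjoint_neq; rewrite ?subvC.
- move=> A B AX cA BX cB /val_inj eAB.
  have : V A = V B by apply: inj_f eAB; rewrite inE edgeL ?subvC.
  by move/(congr1 val); rewrite !valV.
- move=> A B AX cA BX cB AB; rewrite /F.
  have AB' : [disjoint val (V A) & val (V B)] by rewrite !valV.
  apply: (fdis _ _ [set v; V A; V B]); last exact: kneser_disjoint_neq.
  - by apply: triL; rewrite ?subvC //; right.
  - by rewrite !inE eqxx.
  - by rewrite !inE eqxx orbT.
  - by rewrite !inE eqxx orbT.
exists p => t tL vt; rewrite phif //; apply: eq_in_imset => w wt.
apply: val_inj; rewrite permE val_kneser_act.
have [->|nwv] := eqVneq w v.
  by rewrite -[val v]setCK -[val (f v)]setCK -pX !imset_permC.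
have wv : [disjoint val w & val v] by case/kneserP: tL => _; apply.
rewrite -pF ?cv -?disjoints_subset //.
by rewrite /F Vval.
Qed.

(** The edge from u to v and the triangles on it have their image computed by both
    p and q, and phi separates the vertices u and v; so p and q agree on u, on v
    and on the n-subsets avoiding u and v. *)
Lemma local_perms_agree n d (S : finType) (s s' : {set kneser_vertex n S}) phi u v
    (p q : {perm S}) :
  0 < n -> #|S| = n * d + 1 -> s \in kneser n S ->
  open_star_iso (kneser n S) s s' phi -> u \in s -> v \in s -> u != v ->
  (forall t : {set kneser_vertex n S},
    t \in kneser n S -> u \in t -> phi t = kneser_perm n p @: t) ->
  (forall t : {set kneser_vertex n S},
    t \in kneser n S -> v \in t -> phi t = kneser_perm n q @: t) ->
  [/\ p @: val u = q @: val u, p @: val v = q @: val v &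
     {in ~: (val u :|: val v), p =1 q}].
Proof.
move=> n0 cS sL isoP us vs nuv pP qP; set L := kneser n S in isoP sL pP qP *.
set P := kneser_perm n p in pP; set Q := kneser_perm n q in qP.
have [injphi _ _ _] := isoP.
have cv := @card_kneser_vertex n S.
have uL := vertex_simplex L u; have vL := vertex_simplex L v.
have uvL : [set u; v] \in L by apply: edge_simplex us vs.
have ust := mem_open_star us (set11 u) uL.
have vst := mem_open_star vs (set11 v) vL.
have nPQ : P u != Q v.
  apply: contraNneq nuv => e; apply/eqP/set1_inj/injphi => //.
  by rewrite pP ?set11 // qP ?set11 // !imset_set1 e.
have ePQ : [set P u; P v] = [set Q u; Q v].
  by rewrite -!imset_set1 -!imsetU -pP ?set21 // -qP ?set22.
have ev : P v = Q v.
  have : Q v \in [set P u; P v] by rewrite ePQ set22.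
  by rewrite !inE eq_sym (negPf nPQ) => /eqP->.
have eu : P u = Q u.
  have : P u \in [set Q u; Q v] by rewrite -ePQ set21.
  by rewrite !inE (negPf nPQ) orbF => /eqP->.
have valPQ w : P w = Q w -> p @: val w = q @: val w.
  by move/(congr1 val); rewrite !permE !val_kneser_act.
split; try exact: valPQ.
have uv : [disjoint val u & val v] by case/kneserP: sL => _; apply.
have eZ : p @: (val u :|: val v) = q @: (val u :|: val v) by rewrite !imsetU !valPQ.
have cZ : #|~: (val u :|: val v)| + n.*2 = n * d + 1.
  rewrite -cS -(cardsC (val u :|: val v)) cardsU.
  rewrite (eqP (_ : val u :&: val v == set0)) ?setI_eq0 // cards0 subn0.
  by rewrite !cv addnn addnC.
(* If n(d-2) + 1 <= n, then d <= 2 and at most one point remains, which both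
   p and q send to the one outside of the images of u and v. *)
have [ltnZ|leZn] := ltnP n #|~: (val u :|: val v)|; last first.
  have leZ1 : #|~: (val u :|: val v)| <= 1.
    move: (#|_|) cZ leZn => z; clear -n0.
    case: d => [|[|[|d]]]; rewrite ?mulnS; lia.
  move=> x xZ; have ex : ~: (val u :|: val v) = [set x].
    by apply/eqP; rewrite eq_sym eqEcard sub1set xZ cards1.
  by apply: set1_inj; rewrite -!imset_set1 -ex !imset_permC eZ.
apply: (@perm_eq_on _ n); first by rewrite n0.
move=> A AZ cA; pose w : kneser_vertex n S := insubd u A.
have valw : val w = A by rewrite val_insubd cA eqxx.
rewrite -valw; apply: valPQ.
have /andP[wu wv] : [disjoint val w & val u] && [disjoint val w & val v].
  by move: AZ; rewrite valw setCU subsetI !disjoints_subset.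
have nwu := kneser_disjoint_neq n0 wu; have nwv := kneser_disjoint_neq n0 wv.
have tL : [set u; v; w] \in L.
  by apply: kneser_triangle => _; rewrite 1?disjoint_sym // disjoint_sym.
have ut : u \in [set u; v; w] by rewrite !inE eqxx.
have vt : v \in [set u; v; w] by rewrite !inE eqxx orbT.
have : P w \in Q @: [set u; v; w].
  by rewrite -(qP _ tL vt) (pP _ tL ut) imset_f // !inE eqxx orbT.
case/imsetP => x; rewrite !inE => /orP[/orP[]|]/eqP-> //.
  by rewrite -eu => /perm_inj/eqP; rewrite (negPf nwu).
by rewrite -ev => /perm_inj/eqP; rewrite (negPf nwv).
Qed.

(** * Gluing the local permutations *)

Theorem proposition5p3 (n d : nat) (hn : 1 <= n) (hd : 1 <= d) :
  superstar_transitive (kneser n 'I_(n * d + 1)).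
Proof.
move=> s s' sL _ phi isoP _; set S := 'I_(n * d + 1) in s s' sL phi isoP *.
set L := kneser n S in sL isoP *.
have cS : #|S| = n * d + 1 by exact: card_ord.
pose local v (p : {perm S}) := forall t : {set kneser_vertex n S},
   t \in L -> v \in t -> phi t = kneser_perm n p @: t.
have [p pP] : exists p : kneser_vertex n S -> {perm S},
    forall v, v \in s -> local v (p v).
  apply: (fin_all_exists (P := fun v p => v \in s -> local v p)) => v.
  have [vs|//] := boolP (v \in s); last by exists 1%g.
  by have [p pv] := kneser_star_local hn hd cS isoP vs; exists p.
have agree u v : u \in s -> v \in s -> u != v ->
    [/\ p u @: val u = p v @: val u, p u @: val v = p v @: val v &
     {in ~: (val u :|: val v), p u =1 p v}].
  move=> us vs nuv; apply: (local_perms_agree hn cS sL isoP us vs nuv); exact: pP.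
suff [q qp qv] : exists2 q : {perm S},
    forall v, v \in s -> q @: val v = p v @: val v &
    forall v, v \in s -> {in ~: val v, q =1 p v}.
  exists (kneser_perm n q); split; first exact: kneser_perm_automorphism.
  move=> t; rewrite inE => /andP[tL /set0Pn[r]].
  rewrite !inE => /andP[/andP[/andP[r0 _] rt] /andP[_ rs]].
  have [v vr] := set0Pn _ r0; have vt := subsetP rt _ vr.
  have vs := subsetP rs _ vr.
  rewrite (pP v) //; apply: eq_in_imset => w wt; apply: val_inj.
  rewrite !permE !val_kneser_act.
  have [->|nwv] := eqVneq w v; first exact: qp.
  apply: eq_in_imset => x xw; apply: qv => //; apply: subsetP xw.
  by rewrite -disjoints_subset; case/kneserP: tL => _; apply.
have dis u v : u \in s -> v \in s -> u != v -> [disjoint val u & val v].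
  by case/kneserP: sL => _; apply.
have [v0 v0s] := set0Pn _ (simplex_neq0 sL).
have [v1 /andP[v1s nv1]|single] :=
  pickP [pred v | (v \in s) && (v != v0)]; last first.
  exists (p v0) => v vs; have := single v; by rewrite /= vs /= => /negbFE/eqP->.
(* Every x lies outside of [val (c x)]. *)
pose c x := if x \in val v0 then v1 else v0.
pose h x := p (c x) x.
have hE v x : v \in s -> x \notin val v -> h x = p v x.
  move=> vs xv; rewrite /h /c; case: ifP => xv0.
    have [->//|nv] := eqVneq v1 v.
    have [_ _ ->//] := agree v1 v v1s vs nv.
    rewrite !inE negb_or xv andbT.
    by rewrite (disjointFl (dis _ _ v1s v0s nv1)).
  have [->//|nv] := eqVneq v0 v.
  by have [_ _ ->//] := agree v0 v v0s vs nv; rewrite !inE negb_or xv xv0.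
have hv v : v \in s -> h @: val v = p v @: val v.
  move=> vs; have [u us nuv] : exists2 u, u \in s & u != v.
    have [->|nv] := eqVneq v v0; first by exists v1.
    by exists v0; rewrite 1?eq_sym.
  have [_ <- _] := agree u v us vs nuv.
  apply: eq_in_imset => x xv; apply: hE => //.
  by rewrite (disjointFl (dis _ _ us vs nuv)).
(* h equals p v1 on val v0 and p v0 elsewhere, and the two images are disjoint. *)
have hin x : (h x \in p v0 @: val v0) = (x \in val v0).
  have [xv|xv] := boolP (x \in val v0); first by rewrite -hv // imset_f.
  by rewrite (hE v0) // mem_imset ?(negPf xv) //; exact: perm_inj.
have inj_h : injective h.
  move=> x y e; have := hin x; rewrite e hin => exy; move: e; rewrite /h /c exy.
  by case: ifP => _; exact: perm_inj.
exists (perm inj_h) => v vs.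
  by rewrite -hv //; apply: eq_imset => x; rewrite permE.
by move=> x; rewrite inE permE; exact: hE.
Qed.
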